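(* Let $k$ be a positive integer and $0\le l<k$ an integer. For $n\ge k$, let $M(n)$ be the maximum of $|\mathcal V|$ over all $\mathcal V\subset\mathcal L_k$ such that $\langle\mathbf v,\mathbf w\rangle\ne -l-1$ for all $\mathbf v,\mathbf w\in\mathcal V$. Then $M(n)=f(k,l)\binom{n}{k}+O(n^{k-1})$ as $n\to\infty$ (with $k,l$ fixed).
   Context: $\mathcal L_k$ denotes the set of all vectors $\mathbf v\in\{0,\pm1\}^n$ with exactly $k$ nonzero coordinates, and $\langle\cdot,\cdot\rangle$ is the standard scalar product. For integers $0\le s<k$, $f(k,s)=\sum_{i=0}^{s/2}\binom{k}{i}$ if $s$ is even and $f(k,s)=2\sum_{i=0}^{(s-1)/2}\binom{k-1}{i}$ if $s$ is odd (with $f(k,0)=1$). *)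

(* Defs.v *)
From mathcomp Require Import all_boot all_order all_algebra.
From mathcomp Require Import all_classical all_reals all_analysis.

Set Implicit Arguments.
Unset Strict Implicit.
Unset Printing Implicit Defensive.

Import Order.TTheory GRing.Theory Num.Theory.
Import numFieldNormedType.Exports.

Local Open Scope ring_scope.

(* {0, 1, -1} as a finite subtype of [int]; [val] is the inclusion.  Having
   finitely many entries makes ['rV[trit]_n] a [finType], so that families of
   vectors can be taken in [{set 'rV[trit]_n}]. *)
Definition trit : finType := seq_sub [:: 0; 1; -1 : int].

Definition scalar_product n (v w : 'rV[trit]_n) : int :=
  \sum_(i < n) val (v 0 i) * val (w 0 i).

Definition Lk (n k : nat) : {set 'rV[trit]_n} :=
  [set v : 'rV[trit]_n | #|[set i : 'I_n | val (v 0 i) != 0]| == k].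

Definition avoids n (a : int) (V : {set 'rV[trit]_n}) : bool :=
  [forall v in V, forall w in V, scalar_product v w != a].

Definition M (k l n : nat) : nat :=
  (\max_(V : {set 'rV[trit]_n}
           | (V \subset Lk n k) && avoids (- l%:Z - 1)%R V) #|V|)%N.

(* Only meant for s < k; in particular the odd case has k > 0, so that [k.-1]
   is the true predecessor. *)
Definition f (k s : nat) : nat :=
  (if odd s then 2 * \sum_(0 <= i < (s.-1)./2.+1) 'C(k.-1, i)
   else \sum_(0 <= i < s./2.+1) 'C(k, i))%N.

(* Main.v *)
(* Upper bound: deleting the stars of all signed (k-1)-vectors that have at
   most 2k extensions in V costs O(n^(k-1)) vectors.  In what remains, any
   coordinate of any vector can be moved outside a prescribed k-set S.  If two
   remaining vectors v, w with support S had opposite signs on l+1 coordinates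
   of S, one could move every other coordinate of v out of S and reach the
   scalar product -(l+1).  So over each support the sets of negative
   coordinates have diameter at most l, and Kleitman's theorem bounds their
   number by f(k,l).

   Kleitman's theorem: deleting elements compresses a family of diameter l into
   one whose pairwise unions have size at most l; after shifting x to the other
   points, unions of members containing x even have size less than l, so
   splitting along x gives f(k+1,l) = f(k,l) + f(k,l-2).

   Lower bound: take all vectors with at most l/2 negative coordinates, not
   counting, for odd l, the smallest coordinate of the support. *)

Require Import Defs.
From mathcomp Require Import all_boot all_order all_algebra.
From mathcomp Require Import zify.
Set Implicit Arguments.
Unset Strict Implicit.
Unset Printing Implicit Defensive.
Import GRing.Theory Num.Theory.

Definition symdiff (T : finType) (A B : {set T}) := (A :\: B) :|: (B :\: A).

Lemma exists_subset_card (T : finType) (D : {set T}) m :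
  m <= #|D| -> exists2 A : {set T}, A \subset D & #|A| = m.
Proof.
move=> mD; exists [set x in take m (enum D)].
  by apply/subsetP=> x; rewrite inE => /mem_take; rewrite mem_enum.
rewrite cardsE (card_uniqP _) ?take_uniq ?enum_uniq // size_take -cardE.
by case: ltngtP mD.
Qed.

(** * Compressions of set families: deletions and shifts *)

Section Compression.
Variable T : finType.
Implicit Types (A B X : {set T}) (F : {set {set T}}) (phi : {set T} -> {set T}).

Definition compress phi F : {set {set T}} :=
  [set A in F | phi A \in F] :|: phi @: [set A in F | phi A \notin F].

Lemma compressP phi F B :
  reflect ((B \in F /\ phi B \in F) \/
           exists A, [/\ A \in F, phi A \notin F & B = phi A])
          (B \in compress phi F).
Proof.
rewrite !inE; apply: (iffP orP) => [[/andP[]|/imsetP[A]]|[[BF pF]|[A [AF pF ->]]]].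
- by left.
- by rewrite inE => /andP[AF pF] ->; right; exists A.
- by left; apply/andP.
- by right; apply: imset_f; rewrite inE AF.
Qed.

Lemma card_compress phi F :
    {in [set A in F | phi A \notin F] &, injective phi} ->
  #|compress phi F| = #|F|.
Proof.
move=> phi_inj; rewrite cardsU card_in_imset //.
rewrite (_ : _ :&: _ = set0) ?cards0 ?subn0.
  rewrite -(cardsID [set A | phi A \in F] F).
  by congr (_ + _); apply: eq_card => A; rewrite !inE // andbC.
apply/setP=> A; rewrite !inE; apply/negP => /andP[/andP[AF _] /imsetP[B]].
by rewrite inE => /andP[_ /negP nBF] eAB; apply: nBF; rewrite -eAB.
Qed.

Lemma sum_compress_lt phi F A (w : {set T} -> nat) :
    {in [set A in F | phi A \notin F] &, injective phi} ->
    {in F, forall B, phi B \notin F -> w (phi B) < w B} ->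
  A \in F -> phi A \notin F -> \sum_(B in compress phi F) w B < \sum_(B in F) w B.
Proof.
move=> phi_inj w_lt AF nAF.
rewrite [X in X < _](_ : _ = \sum_(B in [set A in F | phi A \in F]) w B
    + \sum_(B in phi @: [set A in F | phi A \notin F]) w B); last first.
  rewrite -bigU /=; first by apply: eq_bigl => B; rewrite [in LHS]inE.
  rewrite -setI_eq0; apply/eqP/setP=> B; rewrite !inE.
  apply/negP => /andP[/andP[BF _] /imsetP[C]].
  by rewrite inE => /andP[_ /negP nCF] eBC; apply: nCF; rewrite -eBC.
rewrite big_imset //= [X in _ < X](big_setID [set B | phi B \in F]) /=.
have -> : [set B in F | phi B \in F] = F :&: [set B | phi B \in F].
  by apply/setP=> B; rewrite !inE.
have -> : [set B in F | phi B \notin F] = F :\: [set B | phi B \in F].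
  by apply/setP=> B; rewrite !inE andbC.
have AD : A \in F :\: [set B | phi B \in F] by rewrite !inE nAF.
rewrite ltn_add2l (bigD1 A) //= [X in _ < X](bigD1 A) //=.
rewrite -addSn leq_add //; first exact: w_lt.
apply: leq_sum => B; rewrite !inE => /andP[/andP[nBF BF] _].
by rewrite ltnW // w_lt.
Qed.

(** Each compression that changes the family lowers its total weight, so the process stops at a
    family stable under every [phi i]. [P] is an invariant carried along. *)
Lemma exists_compressed (I : finType) (phi : I -> {set T} -> {set T})
    (P : {set {set T}} -> Prop) (w : {set T} -> nat) F :
    (forall i, {in [pred A | phi i A != A] &, injective (phi i)}) ->
    (forall i A, phi i A != A -> w (phi i A) < w A) ->
    (forall i F, P F -> P (compress (phi i) F)) ->
    P F ->
  exists F', [/\ #|F'| = #|F|, P F' & forall i A, A \in F' -> phi i A \in F'].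
Proof.
move=> phi_inj w_lt P_compress.
have moved i (G : {set {set T}}) A : A \in [set A in G | phi i A \notin G] -> phi i A != A.
  by rewrite inE => /andP[AG]; apply: contraNneq => ->.
have [m] := ubnP (\sum_(A in F) w A); elim: m F => // m IHm F; rewrite ltnS => Wm PF.
have [/existsP[i /exists_inP[A AF nAF]]|/existsPn stable] :=
    boolP [exists i, [exists A in F, phi i A \notin F]]; last first.
  exists F; split=> // i A AF; apply: contraNT (stable i) => nAF.
  by apply/exists_inP; exists A.
have inj_i : {in [set A in F | phi i A \notin F] &, injective (phi i)}.
  by move=> B C /moved mB /moved mC; apply: phi_inj.
have [||F' [cF' PF' stF']] := IHm (compress (phi i) F).
- apply: leq_trans Wm; apply: sum_compress_lt AF nAF => // B BF nBF.
  by apply: (w_lt i); apply: (moved i F B); rewrite inE BF.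
- exact: P_compress.
by exists F'; split=> //; rewrite cF' card_compress.
Qed.

Definition diam_le l F := forall A B, A \in F -> B \in F -> #|symdiff A B| <= l.
Definition union_le l F := forall A B, A \in F -> B \in F -> #|A :|: B| <= l.
Definition family_on X F := forall A, A \in F -> A \subset X.

(** Only a kept [A] against a moved [B] needs care. If [x \in A], the difference equals that of
    [A :\ x] and [B], both in [F] because [A] was kept. Otherwise deleting [x] from [B] only shrinks
    the difference. *)
Lemma diam_le_compress x l F :
  diam_le l F -> diam_le l (compress (fun A => A :\ x) F).
Proof.
have key A B : A \in F -> B \in F -> A :\ x \in F -> diam_le l F -> B :\ x \notin F ->
    #|symdiff A (B :\ x)| <= l.
  move=> AF BF AxF dF nBF; have xB : x \in B.
    by apply: contraR nBF => xB; rewrite (setDidPl _) // disjoint_sym disjoints1.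
  have [xA|xA] := boolP (x \in A).
    suff -> : symdiff A (B :\ x) = symdiff (A :\ x) B by apply: dF.
    apply/setP=> y; rewrite !inE; have [->|] := eqVneq y x; first by rewrite xA xB.
    by [].
  apply: leq_trans (dF _ _ AF BF); apply: subset_leq_card.
  apply/subsetP=> y; rewrite !inE; have [->|//] := eqVneq y x.
  by rewrite (negPf xA).
have symC A B : symdiff A B = symdiff B A by rewrite /symdiff setUC.
move=> dF A B /compressP[[AF AxF]|[A' [AF nAF ->]]] /compressP[[BF BxF]|[B' [BF nBF ->]]].
- exact: dF.
- exact: key.
- by rewrite symC; apply: key.
apply: leq_trans (dF _ _ AF BF); apply: subset_leq_card.
by apply/subsetP=> y; rewrite !inE; case: eqVneq.
Qed.

(** Compressing by all deletions makes the family closed under subsets. Then [B :\: A] is a member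
    too, and its symmetric difference with [A] is [A :|: B]. *)
Lemma diam_le_to_union_le l X F : family_on X F -> diam_le l F ->
  exists F', [/\ #|F'| = #|F|, family_on X F' & union_le l F'].
Proof.
move=> FX dF.
have [|||| F' [cF' [oF' dF'] down1]] :=
  @exists_compressed T (fun x A => A :\ x) (fun G => family_on X G /\ diam_le l G)
     (fun A => #|A|) F.
- move=> x A B; rewrite !inE => mA mB eAB.
  have mem C : C :\ x != C -> x \in C.
    by apply: contraR => xC; rewrite (setDidPl _) // disjoint_sym disjoints1.
  by rewrite -(setD1K (mem _ mA)) eAB setD1K // mem.
- by move=> x A nA; apply: proper_card; rewrite properEneq nA subD1set.
- move=> x G [oG dG]; split; last exact: diam_le_compress.
  move=> A /compressP[[AG _]|[B [BG _ ->]]]; first exact: oG.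
  exact: subset_trans (subD1set _ _) (oG _ BG).
- by [].
have down A B : A \in F' -> A :\: B \in F'.
  have [m] := ubnP #|A :&: B|; elim: m A => // m IHm A; rewrite ltnS => Am AF.
  have [AB0|[x xAB]] := set_0Vmem (A :&: B).
    by rewrite (setDidPl _) // -setI_eq0 AB0.
  have /setIP[xA xB] := xAB.
  have -> : A :\: B = (A :\ x) :\: B.
    by apply/setP=> y; rewrite !inE; case: eqVneq => // ->; rewrite xB.
  apply: IHm (down1 _ _ AF); apply: leq_trans Am; apply: proper_card.
  rewrite properE; apply/andP; split; first by rewrite setSI // subD1set.
  by apply/subsetPn; exists x; rewrite // !inE eqxx.
exists F'; split=> // A B AF BF.
suff -> : A :|: B = symdiff A (B :\: A) by apply: dF' => //; apply: down.
by apply/setP=> y; rewrite !inE; case: (y \in A); case: (y \in B).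
Qed.

(** The index [i] will range over the whole type; the guard [i \in X] keeps the family on [X]. *)
Definition shift X x i A :=
  if [&& i \in X, x \in A & i \notin A] then i |: (A :\ x) else A.

Lemma shift_moved X x i A : shift X x i A != A ->
  [/\ i \in X, x \in A, i \notin A & shift X x i A = i |: (A :\ x)].
Proof. by rewrite /shift; case: ifP => [/and3P[]|_ /eqP]. Qed.

(** Let [A] be moved and [B] kept. If [i \in B], the union gains nothing. If [B] contains [x] but
    not [i], its own shift lies in [F], and shifting [B] instead of [A] gives the same union. If [B]
    contains neither, the union trades [x] for [i], as it does when both are moved. *)
Lemma union_le_compress X x i l F :
  union_le l F -> union_le l (compress (shift X x i) F).
Proof.
move=> uF.
have key A B : A \in F -> B \in F -> shift X x i B \in F -> shift X x i A \notin F ->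
    #|shift X x i A :|: B| <= l.
  move=> AF BF sBF nAF.
  have [|iX xA iA sA] := @shift_moved X x i A; first by apply: contraNneq nAF => ->.
  have [iB|iB] := boolP (i \in B).
    apply: leq_trans (uF _ _ AF BF); apply: subset_leq_card; rewrite sA.
    apply/subsetP=> y; rewrite !inE; have [->|_] := eqVneq y i; first by rewrite iB !orbT.
    by case/orP => [/=/andP[_ ->]|->] //; rewrite orbT.
  have [xB|xB] := boolP (x \in B).
    have := uF _ _ AF sBF; rewrite sA /shift iX xB iB /=.
    suff -> : A :|: (i |: B :\ x) = (i |: A :\ x) :|: B by [].
    apply/setP=> y; rewrite !inE; have [->|_] := eqVneq y i; first by rewrite /= orbT.
    by have [->|_ //] := eqVneq y x; rewrite xA xB.
  apply: leq_trans (uF _ _ AF BF); rewrite sA.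
  have -> : (i |: A :\ x) :|: B = i |: ((A :|: B) :\ x).
    by apply/setP=> y; rewrite !inE; case: (eqVneq y x) => [->|_];
      rewrite ?(negPf xB) ?orbF ?orbA.
  rewrite cardsU1 [X in _ <= X](cardsD1 x) !inE xA (negPf iA) (negPf iB) andbF.
  by [].
move=> A B /compressP[[AF sAF]|[A' [AF nAF ->]]] /compressP[[BF sBF]|[B' [BF nBF ->]]].
- exact: uF.
- by rewrite setUC; apply: key.
- exact: key.
have [|iX xA iA ->] := @shift_moved X x i A'; first by apply: contraNneq nAF => ->.
have [|_ xB iB ->] := @shift_moved X x i B'; first by apply: contraNneq nBF => ->.
apply: leq_trans (uF _ _ AF BF).
have -> : (i |: A' :\ x) :|: (i |: B' :\ x) = i |: ((A' :|: B') :\ x).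
  by apply/setP=> y; rewrite !inE; case: (eqVneq y x); case: (eqVneq y i).
by rewrite cardsU1 [X in _ <= X](cardsD1 x) !inE xA (negPf iA) (negPf iB) andbF.
Qed.

End Compression.

(** * Identities for [f] *)

Lemma f_recr k l : l < k -> f k.+1 l = f k l + (if l < 2 then 0 else f k l.-2).
Proof.
(* Pascal's rule, summed: for odd [l] it is used one row lower and doubled. The guard [l < 2] in the
   statement matters because [l.-2] truncates to 0 and [f k 0] is 1. *)
case: k => // k _; have pascal n t :
    \sum_(0 <= i < t.+2) 'C(n.+1, i) =
    \sum_(0 <= i < t.+2) 'C(n, i) + \sum_(0 <= i < t.+1) 'C(n, i).
  rewrite big_nat_recl // [X in _ = X + _]big_nat_recl // !bin0 -addnA -big_split /=.
  by congr (_ + _); apply: eq_bigr => i _; rewrite binS.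
case: l => [|[|l]]; rewrite /f /= ?negbK ?big_nat1 ?bin0 //.
case: ifP => ol; last by rewrite pascal.
by case: l ol => //= l _; rewrite pascal mulnDr.
Qed.

(** By symmetry, the lower half of row [2t+1] of Pascal's triangle sums to [2^(2t)]. The value is
    half the number of subsets of [l+1] points, which starts the induction for Kleitman's
    theorem. *)
Lemma f_diag l : f l.+1 l = 2 ^ l.
Proof.
have half t : \sum_(0 <= i < t.+1) 'C(t.*2.+1, i) = 2 ^ t.*2.
  apply/eqP; rewrite -(eqn_pmul2l (isT : 0 < 2)) -expnS mul2n -addnn.
  rewrite -[2]/(1 + 1) expnDn; under [X in _ == X]eq_bigr do rewrite !exp1n !muln1.
  rewrite -(big_mkord xpredT (fun i => 'C(_, i)))
    [X in _ == X](big_cat_nat _ (n := t.+1)) //=; last lia.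
  rewrite eqn_add2l -[X in _ == \big[_/_]_(X <= _ < _) _]add0n big_addn.
  rewrite (_ : t.*2.+2 - t.+1 = t.+1); last lia.
  rewrite big_nat_rev /=; apply/eqP; apply: eq_big_nat => i /andP[_ it].
  by rewrite -bin_sub; [congr ('C(_, _)); lia | lia].
rewrite /f /=; case: ifP => ol.
  have -> : l = (l.-1)./2.*2.+1 by lia.
  by rewrite /= doubleK half expnS.
by have := half l./2; rewrite (_ : l./2.*2 = l) //; lia.
Qed.

(** * Kleitman's theorem on families of bounded diameter *)

Section Kleitman.
Variable T : finType.
Implicit Types (A B X : {set T}) (F : {set {set T}}).

(** Induction on the size of [X] for all [l] at once, since the step calls both [l] and [l.-2]. *)
Lemma union_le_card l X F :
  l < #|X| -> family_on X F -> union_le l F -> #|F| <= f #|X| l.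
Proof.
move eXm : #|X| => m; elim: m l X F eXm => // m IHm l X F cX lm oF uF.
(* Base case: [X] has [l+1] points. No member is the complement of a member, as their union would be
   [X]; so [F] and its complements are disjoint inside the power set. *)
have [/eqP elm|neq_lm] := boolP (l == m).
  rewrite -elm f_diag; rewrite -(leq_pmul2l (isT : 0 < 2)) -expnS elm -cX.
  rewrite -card_powerset mul2n -addnn.
  have injC : {in F &, injective (fun A => X :\: A)}.
    move=> A B AF BF /= /(congr1 (fun D => X :\: D)); rewrite !setDDr !setDv !set0U.
    by rewrite !(setIidPr _) ?oF.
  rewrite -{2}(card_in_imset injC) -cardsUI.
  rewrite (_ : F :&: _ = set0) ?cards0 ?addn0; last first.
    apply/setP=> A; rewrite !inE; apply/negP=> /andP[AF /imsetP[B BF eA]].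
    have := uF _ _ AF BF; rewrite eA leqNgt -ltnS.
    have XU : X \subset X :\: B :|: B.
      by apply/subsetP=> y yX; rewrite !inE yX andbT orNb.
    by rewrite elm -cX ltnS (subset_leq_card XU).
  apply: subset_leq_card; apply/subsetP=> A; rewrite !inE => /orP[/oF //|/imsetP[B _ ->]].
  exact: subsetDl.
have [x xX] : exists x, x \in X by apply/card_gt0P; rewrite cX.
have {neq_lm} lm' : l < m by lia.
(* With the indicator of [x] as weight, the total weight counts the members containing [x], and
   every effective shift lowers it. *)
have [|||| F' [<- [oF' uF'] stF']] :=
  @exists_compressed T T (shift X x) (fun G => family_on X G /\ union_le l G)
     (fun A => x \in A) F.
- move=> i A B; rewrite !inE => /shift_moved[_ xA iA ->] /shift_moved[_ xB iB ->] eAB.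
  rewrite -(setD1K xA) -(setD1K xB); congr (_ |: _).
  by rewrite -(@setU1K _ i (A :\ x)) ?eAB ?setU1K // !inE ?(negPf iA) ?(negPf iB) andbF.
- move=> i A /shift_moved[iX xA iA ->]; rewrite !inE eqxx xA orbF.
  by case: eqP => // exi; rewrite -exi xA in iA.
- move=> i G [oG uG]; split; last exact: union_le_compress.
  move=> A /compressP[[AG _]|[B [BG _ ->]]]; first exact: oG.
  rewrite /shift; case: ifP => [/and3P[iX _ _]|_]; last exact: oG.
  by rewrite subUset sub1set iX (subset_trans (subD1set _ _)) // oG.
- by [].
rewrite f_recr // -(cardsID [set A : {set T} | x \in A] F') addnC.
have cX' : #|X :\ x| = m by have := cardsD1 x X; rewrite cX xX => -[->].
apply: leq_add.
  apply: (IHm l (X :\ x)) => // [A|A B]; rewrite !inE => /andP[xA AF].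
    by rewrite subsetD1 xA oF'.
  by move=> /andP[_ BF]; apply: uF'.
(* Pick [i] in [X] outside the union. Shifting [A] from [x] to [i] adds [i] to the union, while [B]
   still supplies [x]; so there was room for one more point. *)
have uF1 A B : A \in F' -> B \in F' -> x \in A -> x \in B -> #|A :|: B| < l.
  move=> AF BF xA xB.
  have [XAB|/subsetPn[i iX]] := boolP (X \subset A :|: B).
    by have := leq_trans (subset_leq_card XAB) (uF' _ _ AF BF); rewrite cX; lia.
  rewrite inE negb_or => /andP[iA iB].
  have := uF' _ _ (stF' i _ AF) BF; rewrite /shift iX xA iA /=.
  have -> : (i |: A :\ x) :|: B = i |: (A :|: B).
    by apply/setP=> y; rewrite !inE; case: (eqVneq y x) => [->|_]; rewrite ?xA ?xB ?orbT ?orbA.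
  by rewrite cardsU1 inE (negPf iA) (negPf iB).
have [l2|l2] := ltnP l 2.
  rewrite leqn0 cards_eq0; apply/eqP/setP=> A; rewrite !inE; apply/negP=> /andP[AF xA].
  have := uF1 _ _ AF AF xA xA; rewrite setUid (cardsD1 x) xA; lia.
rewrite -(card_in_imset (f := fun A => A :\ x)); last first.
  move=> A B; rewrite !inE => /andP[_ xA] /andP[_ xB] eAB.
  by rewrite -(setD1K xA) eAB setD1K.
(* The bound drops by two: once by the strict inequality [uF1], once by removing the common point
   [x]. *)
apply: (IHm l.-2 (X :\ x)) => //; first lia.
  by move=> _ /imsetP[A + ->]; rewrite inE => /andP[AF _]; rewrite setSD ?oF'.
move=> _ _ /imsetP[A + ->] /imsetP[B + ->]; rewrite !inE => /andP[AF xA] /andP[BF xB].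
have := uF1 _ _ AF BF xA xB; rewrite (cardsD1 x (A :|: B)) inE xA /= setDUl; lia.
Qed.

Lemma kleitman_diameter l X F :
  l < #|X| -> family_on X F -> diam_le l F -> #|F| <= f #|X| l.
Proof.
move=> lX oF dF; have [F' [<- oF' uF']] := diam_le_to_union_le oF dF.
exact: union_le_card.
Qed.

End Kleitman.

(** * Sign vectors as pairs of a support and a set of negative coordinates *)

Section SignedVectors.
Variable n : nat.
Implicit Types (v w u : 'rV[trit]_n) (V : {set 'rV[trit]_n}) (S A : {set 'I_n}).

Definition trit0 : trit := @SeqSub _ [:: 0; 1; -1 : int]%R 0%R isT.
Definition sign (b : bool) : trit :=
  if b then @SeqSub _ [:: 0; 1; -1 : int]%R (-1)%R isT
  else @SeqSub _ [:: 0; 1; -1 : int]%R 1%R isT.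

Lemma tritP (t : trit) : t = trit0 \/ exists b, t = sign b.
Proof.
have := valP t; rewrite !inE => /or3P[] /eqP e; [left|right; exists false|right; exists true];
  exact: val_inj.
Qed.

Definition supp v : {set 'I_n} := [set i | val (v 0%R i) != 0%R].
Definition neg v : {set 'I_n} := [set i | val (v 0%R i) == (-1)%R].

Lemma mem_LkE k v : (v \in Lk n k) = (#|supp v| == k).
Proof. by rewrite inE. Qed.

Lemma neg_sub v : neg v \subset supp v.
Proof. by apply/subsetP=> i; rewrite !inE => /eqP ->. Qed.

Definition signed S A : 'rV[trit]_n :=
  (\row_i if i \in S then sign (i \in A) else trit0)%R.

Lemma supp_signed S A : supp (signed S A) = S.
Proof. by apply/setP=> i; rewrite inE mxE; case: (i \in S); case: (i \in A). Qed.

Lemma neg_signed S A : A \subset S -> neg (signed S A) = A.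
Proof.
move=> AS; apply/setP=> i; rewrite inE mxE; have := subsetP AS i.
by case: (i \in S); case: (i \in A) => // /(_ isT).
Qed.

Lemma signedK v : signed (supp v) (neg v) = v.
Proof.
apply/rowP=> i; rewrite mxE !inE.
by case: (tritP (v 0%R i)) => [->|[[] ->]].
Qed.

Definition negs_over V S : {set {set 'I_n}} := neg @: [set v in V | supp v == S].

(** By [signedK] a vector is recovered from its support and negative set, so [neg] is injective over
    each fixed support. *)
Lemma card_by_supp V : #|V| = \sum_S #|negs_over V S|.
Proof.
rewrite -sum1_card (partition_big supp xpredT) //=.
apply: eq_bigr => S _; rewrite sum1dep_card /negs_over card_in_imset //.
move=> v w; rewrite !inE => /andP[_ /eqP sv] /andP[_ /eqP sw] e.
by rewrite -(signedK v) -(signedK w) sv sw e.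
Qed.

Lemma card_sub_Lk m b V : V \subset Lk n m ->
  (forall S, #|S| = m -> #|negs_over V S| <= b) -> #|V| <= b * 'C(n, m).
Proof.
move=> VL Vb; rewrite card_by_supp -[X in 'C(X, m)]card_ord -card_draws mulnC -sum_nat_const.
rewrite [X in X <= _](bigID [pred S : {set 'I_n} | #|S| == m]) /=.
rewrite [X in _ + X]big1 ?addn0 => [|S nS]; last first.
  apply/eqP; rewrite cards_eq0; apply/eqP/setP=> A; rewrite inE.
  apply/negP=> /imsetP[v]; rewrite inE => /andP[vV /eqP sv] _.
  by have := subsetP VL _ vV; rewrite mem_LkE sv (negPf nS).
rewrite [X in _ <= X](eq_bigl (fun S : {set 'I_n} => #|S| == m)); last first.
  by move=> S; rewrite inE.
by apply: leq_sum => S /eqP /Vb.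
Qed.

Lemma card_Lk m : #|Lk n m| <= 2 ^ m * n ^ m.
Proof.
have: #|Lk n m| <= 2 ^ m * 'C(n, m).
  apply: card_sub_Lk => // S <-; rewrite -card_powerset; apply: subset_leq_card.
  apply/subsetP=> A /imsetP[v]; rewrite inE => /andP[_ /eqP <-] ->.
  by rewrite inE neg_sub.
move/leq_trans; apply; rewrite leq_mul2l; apply/orP; right.
have: 'C(n, m) <= n ^_ m by rewrite -bin_ffact leq_pmulr // fact_gt0.
move/leq_trans; apply; rewrite ffact_prod -[X in n ^ X]card_ord -prod_nat_const.
by apply: leq_prod => i _; rewrite leq_subr.
Qed.

(** * Stars, shadows and robust families *)

Definition upd v i (t : trit) : 'rV[trit]_n := (\row_j if j == i then t else v 0%R j)%R.

Lemma supp_upd0 v i : supp (upd v i trit0) = supp v :\ i.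
Proof. by apply/setP=> j; rewrite !inE mxE; case: (j == i). Qed.

Definition star V u : {set 'rV[trit]_n} :=
  [set w in V | [exists j in supp w, upd w j trit0 == u]].
Definition shadow V : {set 'rV[trit]_n} := [set u | star V u != set0].
Definition robust t V := forall u, star V u != set0 -> t < #|star V u|.

Lemma shadow_sub_Lk k V : V \subset Lk n k -> shadow V \subset Lk n k.-1.
Proof.
move=> VL; apply/subsetP=> u; rewrite inE => /set0Pn[w].
rewrite inE => /andP[/(subsetP VL) + /exists_inP[j jw /eqP <-]].
rewrite !mem_LkE supp_upd0 (cardsD1 j (supp w)) jw => /eqP <-.
by rewrite add1n.
Qed.

(** While some nonempty star has at most [t] members, delete it. This costs at most [t] vectors and
    removes its centre [u] from the shadow for good, so at most [#|shadow V|] stars are deleted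
    before a robust family remains. *)
Lemma card_of_robust t b V :
    (forall V', V' \subset V -> robust t V' -> #|V'| <= b) ->
  #|V| <= b + t * #|shadow V|.
Proof.
have [m] := ubnP #|V|; elim: m V => // m IHm V; rewrite ltnS => Vm Vb.
have [/forallP rV|/forallPn[u]] :=
    boolP [forall u, (star V u != set0) ==> (t < #|star V u|)].
  apply: leq_trans (Vb _ (subxx _) _) (leq_addr _ _).
  by move=> u; apply/implyP.
rewrite negb_imply -leqNgt => /andP[su0 sut].
have sV : star V u \subset V by apply/subsetP=> w; rewrite inE => /andP[].
have cV : #|V| = #|star V u| + #|V :\: star V u|.
  by rewrite -(cardsID (star V u) V) (setIidPr sV).
have s0 : 0 < #|star V u| by rewrite card_gt0.
have IH : #|V :\: star V u| <= b + t * #|shadow (V :\: star V u)|.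
  apply: IHm => [|V' V'V]; first by apply: leq_trans Vm; rewrite cV; lia.
  by apply: Vb; apply: subset_trans V'V (subsetDl _ _).
have : #|shadow (V :\: star V u)| < #|shadow V|.
  apply: proper_card; rewrite properE; apply/andP; split.
    apply/subsetP=> x; rewrite !inE; apply: contra => /eqP x0.
    rewrite -subset0 -x0; apply/subsetP=> w; rewrite !inE.
    by case/andP=> /andP[_ ->] ->.
  apply/subsetPn; exists u; rewrite !inE //; apply/negPn/eqP/setP=> w.
  rewrite [in RHS]inE [in LHS]inE [w \in _ :\: _]inE [w \in star _ _]inE.
  by case: (w \in V); case: [exists _ in _, _].
nia.
Qed.

(** Pigeonhole: an extension of [u] with its new coordinate in [S] is fixed by that position and its
    sign, so there are at most [2 * #|S|] of them, fewer than the star of [u] has. *)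
Lemma robust_replace t V S v i : robust t V -> 2 * #|S| <= t -> v \in V -> i \in supp v ->
  exists w j, [/\ w \in V, j \in supp w, j \notin S & upd w j trit0 = upd v i trit0].
Proof.
move=> rV St vV iv; pose u := upd v i trit0.
have : t < #|star V u|.
  apply: rV; apply/set0Pn; exists v; rewrite inE vV /=.
  by apply/exists_inP; exists i.
case: (pickP [pred w in star V u |
    [exists j in ~: S, (j \in supp w) && (upd w j trit0 == u)]]).
  move=> w /=; rewrite inE => /andP[/andP[wV _] /exists_inP[j]].
  by rewrite inE => jS /andP[jw /eqP ej] _; exists w, j.
move=> none; rewrite ltnNge => /negP[]; apply: leq_trans St.
have -> : 2 * #|S| = #|setX S [set: bool]| by rewrite cardsX cardsT card_bool mulnC.
apply: leq_trans (leq_imset_card (fun p => upd u p.1 (sign p.2)) _).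
apply: subset_leq_card; apply/subsetP=> w wu; have := wu.
rewrite inE => /andP[wV /exists_inP[j jw /eqP ej]].
have [b eb] : exists b, w 0%R j = sign b.
  by case: (tritP (w 0%R j)) => // e; rewrite inE e in jw.
apply/imsetP; exists (j, b) => /=.
  rewrite !inE andbT; apply: contraFT (none w) => /= jS; rewrite /= wu /=.
  by apply/exists_inP; exists j; [rewrite inE | rewrite jw ej eqxx].
apply/rowP=> x; rewrite -ej !mxE; case: eqP => // ->; exact: eb.
Qed.

(** Apply [robust_replace] to the coordinates of [supp v :&: S] outside [A], one at a time. Each new
    coordinate lands outside [S], and the entries on [A] never change. *)
Lemma robust_reduce t V S A v :
    robust t V -> 2 * #|S| <= t -> v \in V -> A \subset supp v :&: S ->
  exists w, [/\ w \in V, supp w :&: S = A & {in A, forall x, w 0%R x = v 0%R x}].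
Proof.
move=> rV St; have [m] := ubnP #|(supp v :&: S) :\: A|.
elim: m v => // m IHm v; rewrite ltnS => vm vV AvS.
have [e0|[i]] := set_0Vmem ((supp v :&: S) :\: A).
  exists v; split=> //; apply/eqP; rewrite eqEsubset AvS andbT.
  by rewrite -setD_eq0 e0.
rewrite !inE => /and3P[iA iv iS].
have iv' : i \in supp v by rewrite inE.
have [w [j [wV jw jS ew]]] := robust_replace rV St vV iv'.
have ewS : supp w :&: S = (supp v :&: S) :\ i.
  have := congr1 (fun u => supp u :&: S) ew; rewrite !supp_upd0 => e.
  rewrite -setIDAC -e; apply/setP=> x; rewrite [in LHS]inE [in RHS]inE in_setD1.
  by case: eqVneq => // ->; rewrite (negPf jS) !andbF.
have [|||w' [w'V w'S w'v]] := IHm w.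
- apply: leq_trans vm; apply: proper_card; rewrite ewS.
  rewrite properE setSD ?subD1set //=; apply/subsetPn; exists i; rewrite !inE ?iA ?eqxx //.
  by rewrite iS iv.
- exact: wV.
- by rewrite ewS subsetD1 AvS.
exists w'; split=> // x xA; rewrite w'v //.
have xi : x != i by apply: contraNneq iA => <-.
have xj : x != j.
  by apply: contraNneq jS => <-; have := subsetP AvS _ xA; rewrite inE => /andP[].
by have := congr1 (fun u : 'rV[trit]_n => u 0%R x) ew; rewrite !mxE (negPf xi) (negPf xj).
Qed.

End SignedVectors.

(** * The upper bound *)

Lemma diam_le_negs_over n k l (V : {set 'rV[trit]_n}) (S : {set 'I_n}) :
    robust (2 * k) V -> avoids (- l%:Z - 1)%R V -> #|S| = k ->
  diam_le l (negs_over V S).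
Proof.
move=> rV aV Sk _ _ /imsetP[v + ->] /imsetP[w + ->].
rewrite !inE => /andP[vV /eqP sv] /andP[wV /eqP sw].
(* [A] consists of exactly [l+1] places where [v] and [w] have opposite signs. *)
rewrite leqNgt; apply/negP=> /exists_subset_card[A AD cA].
have AS : A \subset S.
  apply: subset_trans AD _; rewrite subUset.
  by rewrite -{1}sv -sw !(subset_trans (subsetDl _ _)) ?neg_sub.
have [||v' [v'V v'S v'v]] := @robust_reduce n (2 * k) V S A v rV _ vV.
- by rewrite Sk.
- by rewrite sv setIid.
have := forallP aV v'; rewrite v'V /= => /forallP /(_ w); rewrite wV /= => /negP[].
apply/eqP; rewrite /scalar_product (bigID [pred i in A]) /= [X in (_ + X)%R]big1.
  rewrite addr0 (eq_bigr (fun _ => (-1)%R)) ?sumr_const ?cA; first lia.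
  move=> i iA; rewrite v'v //; have := subsetP AD _ iA; rewrite !inE.
  have : i \in supp v by rewrite sv (subsetP AS).
  have : i \in supp w by rewrite sw (subsetP AS).
  rewrite !inE.
  case: (tritP (v 0%R i)) => [->|[b ->]] //; case: (tritP (w 0%R i)) => [->|[c ->]] //.
  by case: b; case: c.
(* Off [A], one factor vanishes: [w] has support [S], and [supp v'] meets [S] only in [A]. *)
move=> i; rewrite -v'S in_setI negb_and -sw !inE !negbK.
by case/orP => /eqP ->; rewrite ?mul0r ?mulr0.
Qed.

Lemma M_upper k l n : l < k ->
  M k l n <= f k l * 'C(n, k) + 2 * k * 2 ^ k.-1 * n ^ k.-1.
Proof.
move=> lk; apply/bigmax_leqP => V /andP[VL aV].
(* The threshold [2 * k] is twice the support size, as the pigeonhole argument requires. The shadow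
   consists of vectors with [k.-1] nonzero entries, whence the error term. *)
apply: leq_trans (card_of_robust (t := 2 * k) (b := f k l * 'C(n, k)) _) _.
  move=> V' V'V rV'; apply: card_sub_Lk => [|S Sk]; first exact: subset_trans VL.
  have aV' : avoids (- l%:Z - 1)%R V'.
    apply/forall_inP=> v /(subsetP V'V) vV; apply/forall_inP=> w /(subsetP V'V) wV.
    exact: (forall_inP (forall_inP aV _ vV)).
  rewrite -Sk; apply: kleitman_diameter; first by rewrite Sk.
    move=> _ /imsetP[v + ->]; rewrite inE => /andP[_ /eqP <-]; exact: neg_sub.
  exact: diam_le_negs_over rV' aV' Sk.
rewrite leq_add2l -(mulnA (2 * k) (2 ^ _)) leq_mul2l; apply/orP; right.
exact: leq_trans (subset_leq_card (shadow_sub_Lk VL)) (card_Lk _ _).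
Qed.

(** * The lower bound *)

Lemma card_small_subsets (T : finType) (S : {set T}) t :
  #|[set A : {set T} | A \subset S & #|A| <= t]| = \sum_(0 <= i < t.+1) 'C(#|S|, i).
Proof.
elim: t => [|t IHt].
  rewrite big_nat1 -cards_draws; apply: eq_card => A; rewrite !inE.
  by rewrite leqn0.
rewrite big_nat_recr //= -IHt -cards_draws.
rewrite -[LHS](cardsID [set A : {set T} | #|A| <= t]); congr (_ + _).
  by apply: eq_card => A; rewrite !inE; case: (A \subset S) => //=; lia.
by apply: eq_card => A; rewrite !inE; case: (A \subset S) => //=; lia.
Qed.

Section LowerBound.
Variables n l : nat.
Implicit Types (S A : {set 'I_n}) (v w : 'rV[trit]_n).

(* For odd [l] the sign at the smallest element of the support is free. *)
Definition core S A : {set 'I_n} :=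
  if odd l then [set i in A | [exists j in S, j < i]] else A.

Definition few_negs k : {set 'rV[trit]_n} :=
  [set v in Lk n k | #|core (supp v) (neg v)| <= l./2].

(** For odd [l], [core] discards the least element [m] of [S]. A small subset of [S :\ m] and a free
    bit for [m] therefore give the factor 2 and the [k.-1] in [f]. *)
Lemma card_core S : l < #|S| ->
  f #|S| l <= #|[set A : {set 'I_n} | A \subset S & #|core S A| <= l./2]|.
Proof.
rewrite /f /core => lS; case: ifP => ol; last by rewrite card_small_subsets.
have [i0 i0S] : exists i, i \in S by apply/card_gt0P; lia.
have [m mS mmin] : exists2 m, m \in S & forall j, j \in S -> m <= j.
  by case: (arg_minnP (fun i : 'I_n => i : nat) i0S) => m; exists m.
have cS : #|S| = #|S :\ m|.+1 by rewrite (cardsD1 m S) mS.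
rewrite {1}cS /= -card_small_subsets -card_bool -cardsT mulnC -cardsX.
rewrite -(card_in_imset (f := fun p : {set 'I_n} * bool => if p.2 then m |: p.1 else p.1)).
  apply: subset_leq_card; apply/subsetP=> _ /imsetP[[A b] + ->].
  rewrite !inE /= andbT subsetD1 => /andP[/andP[AS mA] At].
  rewrite (fun_if (fun B : {set 'I_n} => B \subset S)) subUset sub1set mS AS if_same /=.
  have -> : l./2 = l.-1./2 by lia.
  apply: leq_trans At; apply: subset_leq_card; apply/subsetP=> i.
  rewrite inE => /andP[iA /exists_inP[j jS ji]].
  case: b iA => //; rewrite inE => /orP[|//]; rewrite inE => /eqP eim.
  by have := mmin j jS; rewrite -eim leqNgt ji.
move=> [A b] [B c]; rewrite !inE /= !andbT !subsetD1.
move=> /andP[/andP[_ mA] _] /andP[/andP[_ mB] _].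
case: b; case: c => eAB; rewrite ?eAB //.
- by rewrite -(setU1K mA) eAB setU1K.
- by rewrite -eAB !inE eqxx in mB.
- by rewrite eAB !inE eqxx in mA.
Qed.

Lemma card_few_negs k : l < k -> f k l * 'C(n, k) <= #|few_negs k|.
Proof.
move=> lk; rewrite card_by_supp -[X in 'C(X, k)]card_ord -card_draws mulnC -sum_nat_const.
rewrite [X in _ <= X](bigID [pred S : {set 'I_n} | #|S| == k]) /=.
rewrite [X in X <= _](eq_bigl (fun S : {set 'I_n} => #|S| == k)); last first.
  by move=> S; rewrite inE.
apply: leq_trans (leq_addr _ _); apply: leq_sum => S /eqP Sk.
rewrite -{1}Sk; apply: leq_trans (card_core _) _; first by rewrite Sk.
apply: subset_leq_card; apply/subsetP=> A; rewrite inE => /andP[AS cA].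
apply/imsetP; exists (signed S A); last by rewrite neg_signed.
by rewrite inE supp_signed eqxx andbT inE mem_LkE supp_signed neg_signed // Sk eqxx.
Qed.

Lemma avoids_few_negs k : avoids (- l%:Z - 1)%R (few_negs k).
Proof.
apply/forall_inP=> v; rewrite inE => /andP[_ cv].
apply/forall_inP=> w; rewrite inE => /andP[_ cw].
(* Only the places in [D] contribute negatively to the product, so it suffices that [D] has at most
   [l] elements. *)
pose D := [set i | (val (v 0%R i) * val (w 0%R i) == -1)%R].
have DS i : i \in D -> [/\ i \in supp v, i \in supp w & (i \in neg v) || (i \in neg w)].
  rewrite !inE.
  by case: (tritP (v 0%R i)) => [->|[[] ->]]; case: (tritP (w 0%R i)) => [->|[[] ->]].
have : (- (#|D|)%:Z <= scalar_product v w)%R.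
  rewrite /scalar_product -[X in (- X)%R]natz -sum1_card natr_sum -sumrN big_mkcond /=.
  apply: ler_sum => i _; rewrite inE.
  by case: (tritP (v 0%R i)) => [->|[[] ->]]; case: (tritP (w 0%R i)) => [->|[[] ->]].
have : #|D| <= l.
  pose E := core (supp v) (neg v) :|: core (supp w) (neg w).
  have cE : #|E| <= l./2 + l./2.
    by apply: leq_trans (leq_card_setU _ _) _; apply: leq_add.
  have [ol|ol] := boolP (odd l); last first.
    have DE : D \subset E.
      by apply/subsetP=> i /DS[_ _]; rewrite /E /core (negPf ol) in_setU.
    apply: leq_trans (subset_leq_card DE) (leq_trans cE _); lia.
  (* A negative place missed by [core] is the least of its support, and both supports contain [D].
     So it is the least element of [D], and [D] has at most [1 + 2 * l./2 = l] elements. *)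
  have DE : #|D :\: E| <= 1.
    apply/card_le1_eqP.
    have min i j : i \in D :\: E -> j \in D -> i <= j.
      case/setDP=> /DS[iv iw ivw]; rewrite in_setU => /norP[niv niw] /DS[jv jw _].
      rewrite leqNgt; apply/negP=> ji; case/orP: ivw => [ivn|iwn].
        by case/negP: niv; rewrite /core ol inE ivn; apply/exists_inP; exists j.
      by case/negP: niw; rewrite /core ol inE iwn; apply/exists_inP; exists j.
    move=> i j iDE jDE; apply: val_inj; apply/eqP; rewrite eqn_leq !min //.
      by case/setDP: jDE.
    by case/setDP: iDE.
  rewrite -(cardsID E D); apply: leq_trans (leq_add (leq_trans _ cE) DE) _.
    by rewrite subset_leq_card ?subsetIr.
  lia.
lia.
Qed.

End LowerBound.

Lemma M_lower k l n : l < k -> f k l * 'C(n, k) <= M k l n.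
Proof.
move=> lk; apply: leq_trans (card_few_negs n lk) _.
apply: (@leq_bigmax_cond _ _ (fun V : {set 'rV[trit]_n} => #|V|)).
rewrite avoids_few_negs andbT; apply/subsetP=> v.
by rewrite inE => /andP[].
Qed.

(* The asymptotic statement over the reals *)
From mathcomp Require Import all_classical all_reals all_analysis.
Import Order.TTheory GRing.Theory Num.Theory.
Import numFieldNormedType.Exports.
Local Open Scope classical_set_scope.
Local Open Scope ring_scope.

Theorem theorem2 (R : realType) (k l : nat) (k_gt0 : (0 < k)%N)
    (l_lt_k : (l < k)%N) :
  (fun n : nat => (M k l n)%:R : R^o) =
    (fun n : nat => (f k l)%:R * ('C(n, k))%:R : R^o)
      +O_\oo (fun n : nat => n%:R ^+ k.-1 : R^o).
Proof.
(* The constant comes from [M_upper], whose bound holds for every [n]; [M_lower] makes the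
   difference nonnegative, which removes the absolute value. *)
apply/eqaddOP; exists (2 * k * 2 ^ k.-1)%:R; split; first exact: realn.
move=> c lt_c; near=> n.
rewrite !fctE /= -natrM -natrX normr_nat.
rewrite ger0_norm ?subr_ge0 ?ler_nat ?M_lower // -natrB ?M_lower //.
have Mn := M_upper n l_lt_k.
apply: (@le_trans _ _ (2 * k * 2 ^ k.-1 * n ^ k.-1)%:R).
  by rewrite ler_nat leq_subLR.
by rewrite natrM ler_wpM2r // ltW.
Unshelve. all: by end_near. Qed.
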